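(* Let $N\ge 1$ be an integer and let $\alpha>0$ and $\sigma>0$ be real constants. Then there exists a positive convex function $z\in C^{2}(\mathbb{R}^{N})$ satisfying $$-2\sigma^{2}\Delta z(x)+|\nabla z(x)|^{2}+4\alpha z(x)=4|x|^{2}\quad\text{for all }x\in\mathbb{R}^{N}.$$ Moreover, the following estimates hold: $$0\le z(x)\le |x|^{2}+1+\frac{N}{\alpha}\sigma^{2}\quad\text{for all }x\in\mathbb{R}^{N},$$ and there is a positive constant $C$ such that $$|\nabla z(x)|\le C(1+|x|)\quad\text{for all }x\in\mathbb{R}^{N}.$$
   Context: $|\cdot|$ denotes the Euclidean norm on $\mathbb{R}^{N}$, $\Delta$ the Laplacian and $\nabla$ the gradient. *)

(* Defs.v *)
From HB Require Import structures.
From mathcomp Require Import all_boot all_order all_algebra.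
From mathcomp Require Import all_classical all_reals all_analysis.

Set Implicit Arguments.
Unset Strict Implicit.
Unset Printing Implicit Defensive.

Import Order.TTheory GRing.Theory Num.Theory.
Import numFieldNormedType.Exports.

Local Open Scope classical_set_scope.
Local Open Scope ring_scope.

(* The library norm `|x| on 'rV[R]_N is the sup norm; it induces the usual
   topology, but it is not the Euclidean norm. *)
Definition enorm (R : realType) (N : nat) (x : 'rV[R]_N) : R :=
  Num.sqrt (\sum_(i < N) x ord0 i ^+ 2).

Definition partial (R : realType) (N : nat) (i : 'I_N) (f : 'rV[R]_N -> R) :
    'rV[R]_N -> R :=
  fun x => 'D_(delta_mx ord0 i) f x.

Definition gradient (R : realType) (N : nat) (f : 'rV[R]_N -> R)
    (x : 'rV[R]_N) : 'rV[R]_N :=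
  \row_(i < N) partial i f x.

Definition laplacian (R : realType) (N : nat) (f : 'rV[R]_N -> R)
    (x : 'rV[R]_N) : R :=
  \sum_(i < N) partial i (partial i f) x.

(* f is in C^k(R^N): all partial derivatives of f up to order k exist and are
   continuous on the whole space.  The existence clause is needed because 'D is
   a total operator. *)
Fixpoint class_C (R : realType) (N : nat) (k : nat) (f : 'rV[R]_N -> R) :
    Prop :=
  continuous f /\
  if k is k'.+1 then
    forall i : 'I_N,
      (forall x, derivable f x (delta_mx ord0 i)) /\ class_C k' (partial i f)
  else True.

(* Main.v *)
Require Import Defs.
From HB Require Import structures.
From mathcomp Require Import all_boot all_order all_algebra.
From mathcomp Require Import all_classical all_reals all_analysis.
From mathcomp Require Import ring lra.
Import Order.TTheory GRing.Theory Num.Theory.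
Import numFieldNormedType.Exports.
Local Open Scope classical_set_scope.
Local Open Scope ring_scope.

(* The equation has a radial quadratic solution: for z = a |x|^2 + b it reduces
   to a^2 + alpha a = 1 and alpha b = a N sigma^2, and the positive root
   a = (sqrt (alpha^2 + 4) - alpha) / 2 lies in ]0, 1[. *)

Lemma enorm_sqr (R : realType) (N : nat) (x : 'rV[R]_N) :
  enorm x ^+ 2 = \sum_(i < N) x ord0 i ^+ 2.
Proof. by rewrite sqr_sqrtr// sumr_ge0// => i _; rewrite sqr_ge0. Qed.

Lemma enorm_ge0 (R : realType) (N : nat) (x : 'rV[R]_N) : 0 <= enorm x.
Proof. exact: sqrtr_ge0. Qed.

Lemma enormZ (R : realType) (N : nat) (c : R) (x : 'rV[R]_N) :
  enorm (c *: x) = `|c| * enorm x.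
Proof.
rewrite /enorm -sqrtr_sqr -sqrtrM ?sqr_ge0// mulr_sumr.
by congr Num.sqrt; apply: eq_bigr => i _; rewrite mxE exprMn.
Qed.

(** A polynomial identity in each coordinate, summed. The subtracted term is the exact convexity
    defect of the squared norm, so convexity will follow from its sign alone, with no appeal to the
    Hessian. *)
Lemma enorm_sqr_conv (R : realType) (N : nat) (t : R) (x y : 'rV[R]_N) :
  enorm (t *: x + (1 - t) *: y) ^+ 2 =
  t * enorm x ^+ 2 + (1 - t) * enorm y ^+ 2 - t * (1 - t) * enorm (x - y) ^+ 2.
Proof.
rewrite !enorm_sqr !mulr_sumr -big_split -sumrB; apply: eq_bigr => i _.
by rewrite !mxE/=; ring.
Qed.

(** A coordinate is linear, so its difference quotient equals [v ord0 j] for every nonzero [h]: the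
    limit is that of a constant. *)
Lemma is_derive_coord (R : realType) (N : nat) (j : 'I_N) (x v : 'rV[R]_N) :
  is_derive x v (fun y : 'rV[R]_N => y ord0 j) (v ord0 j).
Proof.
have cvgE : h^-1 *: ((h *: v + x) ord0 j - x ord0 j) @[h --> 0^'] -->
    v ord0 j.
  apply: cvg_near_cst; near=> h.
  have h0 : h != 0 by near: h; exact: nbhs_dnbhs_neq.
  by rewrite !mxE addrK /GRing.scale/= mulKf.
apply: DeriveDef; first by apply/cvg_ex; exists (v ord0 j).
exact: cvg_lim cvgE.
Unshelve. all: by end_near. Qed.

Section radial_quadratic.
Variables (R : realType) (N : nat) (a b : R).

Definition radial_quadratic (x : 'rV[R]_N) : R := a * enorm x ^+ 2 + b.

Local Notation q := radial_quadratic.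

Lemma is_derive_radial_quadratic (x v : 'rV[R]_N) :
  is_derive x v q (a * \sum_(i < N) 2 * x ord0 i * v ord0 i).
Proof.
(* Replacing the squared norm by a sum of squared coordinates removes the square root, which is not
   differentiable at the origin, and exposes a form to which the derivation rules apply. *)
have -> : q = a \*: (\sum_(i < N) (fun y : 'rV[R]_N => y ord0 i) ^+ 2) + cst b.
  apply/funext => y; rewrite /q enorm_sqr; congr (a * _ + b).
  by rewrite fct_sumE; apply: eq_bigr.
apply: is_derive_eq.
  apply: is_deriveD; apply: is_deriveZ; apply: is_derive_sum => i.
  by apply: is_deriveX; exact: is_derive_coord.
by rewrite addr0.
Qed.

Lemma partial_radial_quadratic i :
  partial i q = (fun x : 'rV[R]_N => 2 * a * x ord0 i).
Proof.
apply/funext => x; rewrite /partial.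
rewrite (@derive_val _ _ _ _ _ _ _ (is_derive_radial_quadratic x _)).
rewrite (bigD1 i)//= big1 => [|j ji]; rewrite mxE !eqxx/=; first by ring.
by rewrite (negPf ji) mulr0.
Qed.

Lemma is_derive_partial_radial_quadratic i j (x : 'rV[R]_N) :
  is_derive x (delta_mx ord0 j) (partial i q) (2 * a * (i == j)%:R).
Proof.
rewrite partial_radial_quadratic.
have := is_deriveZ (2 * a) (is_derive_coord _ _ i x (delta_mx ord0 j)).
by rewrite mxE eqxx.
Qed.

(** The Hessian is [2 * a] times the identity; its being constant gives the Laplacian and the last
    stage of C^2 regularity. *)
Lemma partial2_radial_quadratic i j :
  partial j (partial i q) = cst (2 * a * (i == j)%:R).
Proof.
apply/funext => x.
exact: (@derive_val _ _ _ _ _ _ _ (is_derive_partial_radial_quadratic i j x)).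
Qed.

Lemma gradient_radial_quadratic x : gradient q x = (2 * a) *: x.
Proof. by apply/rowP => i; rewrite !mxE partial_radial_quadratic. Qed.

Lemma laplacian_radial_quadratic x : laplacian q x = 2 * a * N%:R.
Proof.
rewrite /laplacian; under eq_bigr => i _.
  rewrite partial2_radial_quadratic eqxx mulr1.
over.
by rewrite sumr_const card_ord mulr_natr.
Qed.

Lemma class_C2_radial_quadratic : class_C 2 q.
Proof.
have ccoord i : continuous (fun x : 'rV[R]_N => x ord0 i).
  by move=> x; exact: coord_continuous.
split.
  have -> : q = (fun x => a * (\sum_(i < N) x ord0 i ^+ 2) + b).
    by apply/funext => x; rewrite /q enorm_sqr.
  have csum : continuous (fun x : 'rV[R]_N => \sum_(i < N) x ord0 i ^+ 2).
    apply: continuous_big => [|i _]; first exact: add_continuous.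
    move=> x; exact: (continuousM (ccoord i x) (ccoord i x)).
  move=> x.
  exact: (continuousD (continuousM (@cst_continuous _ _ a x) (csum x))
    (@cst_continuous _ _ b x)).
move=> i; split=> [x|].
  exact: (@ex_derive _ _ _ _ _ _ _ (is_derive_radial_quadratic x _)).
split.
  rewrite partial_radial_quadratic => x.
  exact: (continuousM (@cst_continuous _ _ (2 * a) x) (ccoord i x)).
move=> j; split=> [x|].
  exact: (@ex_derive _ _ _ _ _ _ _ (is_derive_partial_radial_quadratic i j x)).
by rewrite partial2_radial_quadratic; split => // x; exact: cst_continuous.
Qed.

Lemma convex_radial_quadratic :
  0 <= a -> @convex_function R 'rV[R]_N [set: 'rV[R]_N] q.
Proof.
move=> a0 t x y _ _; rewrite convRE.
have t0 : 0 <= t%:num by [].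
have t1 : t%:num <= 1 by [].
(* The abstract convex combination of row vectors is convertible to the explicit one. *)
change (q (t%:num *: (x : 'rV[R]_N) + (1 - t%:num) *: (y : 'rV[R]_N)) <=
  t%:num * q x + (1 - t%:num) * q y).
move: (t%:num) t0 t1 => s s0 s1.
(* By [enorm_sqr_conv] this is the gap between the two sides; once its sign is known, the goal is
   linear in the remaining monomials. *)
have d0 : 0 <= a * (s * (1 - s) * enorm (x - y : 'rV[R]_N) ^+ 2).
  by rewrite !mulr_ge0 ?subr_ge0 ?enorm_ge0.
rewrite /q enorm_sqr_conv; lra.
Qed.

End radial_quadratic.

(** Since [alpha] is positive, [alpha ^+ 2 + 4] lies strictly between the squares of [alpha] and
    [alpha + 2], hence [s] lies between these two numbers. *)
Lemma quadratic_root_in01 (R : realType) (alpha : R) : 0 < alpha ->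
  exists a : R, [/\ 0 < a, a < 1 & a ^+ 2 + alpha * a = 1].
Proof.
move=> alpha0; set s := Num.sqrt (alpha ^+ 2 + 4).
have s2 : s ^+ 2 = alpha ^+ 2 + 4 by rewrite sqr_sqrtr//; nra.
have s0 : 0 <= s by exact: sqrtr_ge0.
by exists ((s - alpha) / 2); split; nra.
Qed.

Theorem theorem1 (R : realType) (N : nat) (alpha sigma : R)
    (hN : (1 <= N)%N) (halpha : 0 < alpha) (hsigma : 0 < sigma) :
  exists z : 'rV[R]_N -> R,
    (forall x : 'rV[R]_N, 0 < z x) /\
    @convex_function R 'rV[R]_N [set: 'rV[R]_N] z /\
    class_C 2 z /\
    (forall x : 'rV[R]_N,
      - (2 * sigma ^+ 2 * laplacian z x) + enorm (gradient z x) ^+ 2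
        + 4 * alpha * z x = 4 * enorm x ^+ 2) /\
    (forall x : 'rV[R]_N,
      0 <= z x <= enorm x ^+ 2 + 1 + N%:R / alpha * sigma ^+ 2) /\
    (exists C : R, 0 < C /\
      forall x : 'rV[R]_N, enorm (gradient z x) <= C * (1 + enorm x)).
Proof.
have [a [a0 a1 aE]] := quadratic_root_in01 _ _ halpha.
(* This is the constant of the upper bound; the constant term of the solution is [a * c]. *)
set c := N%:R / alpha * sigma ^+ 2.
have c0 : 0 < c by rewrite mulr_gt0 ?exprn_gt0// divr_gt0// ltr0n.
have cE : alpha * c = N%:R * sigma ^+ 2 by rewrite /c; field; rewrite gt_eqF.
(* Strict positivity comes from the constant term, since the quadratic term vanishes at the
   origin. *)
have q0 x : 0 < radial_quadratic R N a (a * c) x.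
  rewrite /radial_quadratic; apply: ltr_wpDl; last exact: mulr_gt0.
  by rewrite mulr_ge0 ?sqr_ge0 ?ltW.
exists (radial_quadratic R N a (a * c)); split; first exact: q0.
split; first exact/convex_radial_quadratic/ltW.
split; first exact: class_C2_radial_quadratic.
split=> [x|].
  rewrite laplacian_radial_quadratic gradient_radial_quadratic enormZ exprMn.
  rewrite real_normK ?num_real// /radial_quadratic.
  (* Collecting powers of the norm isolates the two relations [aE] and [cE]. *)
  transitivity (4 * (a ^+ 2 + alpha * a) * enorm x ^+ 2 +
    4 * a * (alpha * c - N%:R * sigma ^+ 2)); first by ring.
  by rewrite aE cE subrr; ring.
split=> [x|].
  rewrite (ltW (q0 x))/= /radial_quadratic.
  (* As [a < 1], each of the two terms is at most its counterpart without the factor [a]. *)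
  by have := sqr_ge0 (enorm x); nra.
exists (2 * a); split; first by rewrite mulr_gt0.
move=> x; rewrite gradient_radial_quadratic enormZ ger0_norm; last by lra.
by rewrite ler_pM2l ?mulr_gt0// lerDr.
Qed.
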